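(* Every caterpillar of diameter $4$ with an odd number of edges is super edge-graceful, except the trees $RT(0^j,1,a_{j+2})$ where $j$ and $a_{j+2}$ are positive odd integers with $j=1$ or $a_{j+2}=1$ (these exceptional trees are not super edge-graceful).
   Context: A caterpillar is a tree such that removing all its leaves leaves a path. For a finite simple graph $G$ with $p$ vertices and $q$ edges, $G$ is super edge-graceful if there is a bijection $f$ from $E(G)$ onto $\{0,\pm1,\ldots,\pm\frac{q-1}{2}\}$ when $q$ is odd, and onto $\{\pm1,\ldots,\pm\frac{q}{2}\}$ when $q$ is even, such that the induced vertex labeling $f^+(v)=\sum_{uv\in E(G)} f(uv)$ is a bijection from $V(G)$ onto $\{0,\pm1,\ldots,\pm\frac{p-1}{2}\}$ when $p$ is odd, and onto $\{\pm1,\ldots,\pm\frac{p}{2}\}$ when $p$ is even. For nonnegative integers $a_1,\ldots,a_n$, $RT(a_1,\ldots,a_n)$ denotes the rooted tree with root $v_0$, children $v_1,\ldots,v_n$ of $v_0$, and where $v_i$ has exactly $a_i$ children, all of which are leaves. The notation $m^t$ in the list means $m$ repeated $t$ times (omitted if $t=0$). Thus $RT(0^j,1,a_{j+2})$ is the tree whose root has $j$ leaf children, one child with exactly one (leaf) child, and one child with exactly $a_{j+2}$ leaf children. *)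

(* Defs.v *)
From mathcomp Require Import all_boot all_order all_algebra.

Set Implicit Arguments.
Unset Strict Implicit.
Unset Printing Implicit Defensive.

Record sgraph := SGraph {
  vertex :> finType;
  adj : rel vertex;
  adj_sym : symmetric adj;
  adj_irrefl : irreflexive adj }.

Definition edges (G : sgraph) : {set {set G}} :=
  [set E : {set G} | [exists u, exists v, adj u v && (E == [set u; v])]].

Definition degree (G : sgraph) (v : G) : nat := #|[set u | adj v u]|.

Definition leaf (G : sgraph) (v : G) : bool := degree v == 1.

Definition isomorphic (G H : sgraph) : Prop :=
  exists2 f : G -> H, bijective f & {mono f : u v / adj u v}.

Section Induced.
Variables (G : sgraph) (P : pred G).

Definition induced_adj : rel {v : G | P v} := fun u v => adj (val u) (val v).

Lemma induced_adj_sym : symmetric induced_adj.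
Proof. by move=> u v; rewrite /induced_adj adj_sym. Qed.

Lemma induced_adj_irrefl : irreflexive induced_adj.
Proof. by move=> u; rewrite /induced_adj adj_irrefl. Qed.

Definition induced : sgraph := SGraph induced_adj_sym induced_adj_irrefl.
End Induced.

Section PathGraph.
Variable n : nat.

Definition path_adj : rel 'I_n := fun i j => (i.+1 == j) || (j.+1 == i).

Lemma path_adj_sym : symmetric path_adj.
Proof. by move=> i j; rewrite /path_adj orbC. Qed.

Lemma path_adj_irrefl : irreflexive path_adj.
Proof. by move=> i; rewrite /path_adj orbb gtn_eqF. Qed.

Definition path_graph : sgraph := SGraph path_adj_sym path_adj_irrefl.
End PathGraph.

Definition connected (G : sgraph) : Prop :=
  0 < #|G| /\ forall u v : G, connect (@adj G) u v.

(* The size condition discards the closed walks [:: u; v] along one edge. *)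
Definition acyclic (G : sgraph) : Prop :=
  forall c : seq G, 2 < size c -> ~ ucycle (@adj G) c.

Definition tree (G : sgraph) : Prop := connected G /\ acyclic G.

(* The path graph on 0 vertices is allowed, so that K_2 counts as a
   caterpillar. *)
Definition caterpillar (G : sgraph) : Prop :=
  tree G /\ exists n, isomorphic (induced [pred v : G | ~~ leaf v]) (path_graph n).

Definition walk (G : sgraph) (u v : G) (n : nat) : bool :=
  [exists p : n.-tuple G, path (@adj G) u p && (last u p == v)].

(* Least length of a walk from u to v. Two connected vertices are at distance
   less than #|G|; the value #|G| is returned when there is no walk. *)
Definition dist (G : sgraph) (u v : G) : nat :=
  find (walk u v) (iota 0 #|G|).

Definition diameter (G : sgraph) : nat := \max_(u : G) \max_(v : G) dist u v.

(* {0, ±1, ..., ±(n-1)/2} for n odd, {±1, ..., ±n/2} for n even; n./2 is the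
   floor of n/2. *)
Definition labels (n : nat) : pred int :=
  [pred z : int | (`|z|%N <= n./2) && (odd n || (z != 0%R))].

Definition bij_onto (T U : eqType) (A : {pred T}) (B : {pred U}) (f : T -> U) :
    Prop :=
  [/\ {in A, forall x, f x \in B}, {in A &, injective f}
    & {in B, forall y, exists2 x, x \in A & f x = y}].

(* An edge labeling is represented by a function on all sets of vertices, of
   which only the values on edges matter. *)
Definition induced_label (G : sgraph) (f : {set G} -> int) (v : G) : int :=
  (\sum_(u : G | adj u v) f [set u; v])%R.

Definition super_edge_graceful (G : sgraph) : Prop :=
  exists f : {set G} -> int,
    bij_onto (mem (edges G)) (labels #|edges G|) f /\
    bij_onto (mem [set: G]) (labels #|G|) (induced_label f).

Section RT.
Variable a : seq nat.

(* None is the root v_0, Some (Tagged _ None) the child with index i, and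
   Some (Tagged _ (Some k)) the k-th child of that child; indices start at 0. *)
Definition RT_vertex : finType :=
  option {i : 'I_(size a) & option 'I_(nth 0 a i)}.

Definition RT_parent (x : RT_vertex) : option RT_vertex :=
  match x with
  | None => None
  | Some (existT i None) => Some None
  | Some (existT i (Some _)) => Some (Some (existT _ i None))
  end.

Definition RT_adj : rel RT_vertex :=
  fun x y => (RT_parent x == Some y) || (RT_parent y == Some x).

Lemma RT_adj_sym : symmetric RT_adj.
Proof. by move=> x y; rewrite /RT_adj orbC. Qed.

Lemma RT_adj_irrefl : irreflexive RT_adj.
Proof.
move=> x; rewrite /RT_adj orbb; apply/eqP.
by case: x => [[i [k|]]|] //= [] /eqP; rewrite eq_Tagged.
Qed.

Definition RT : sgraph := SGraph RT_adj_sym RT_adj_irrefl.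
End RT.

(* Main.v *)
Require Import Defs.
From mathcomp Require Import all_boot all_order all_algebra.
From mathcomp Require Import zify.

(* A caterpillar of diameter 4 is a path x - c - y with j leaves attached to c,
   a > 0 to x and b > 0 to y. A leaf has the label of its pendant edge, which
   is thus not 0, so that 0 labels cx or cy.

   With m the largest edge label, put 0 on cx and -1 on cy. If exactly one of j,
   a, b is odd, one may take a even; the leaves of x receive m, 1 and those of
   the odd vertex receive -m. If all are odd and two of them are at least 3, one
   may take a >= 3; the leaves of x receive m, -2, 3, those of one of c, y
   receive -m and those of the other 1, 2, -3. All other labels come in pairs t,
   -t, which are distributed among the three sets of leaves. Then x is
   labeled by m + 1, and c and y by -(m + 1) and -1 in some order.

   Conversely, if a = 1 then 0 is not on cx, since x would have the same label
   as its leaf. So a = b = 1 is impossible. If a = j = 1, then cy has label 0,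
   and the label e of cx can only reappear at y, so c and x are labeled by
   m + 1 and -(m + 1); but these labels differ by the difference of two edge
   labels, at most 2 m. *)

Set Implicit Arguments.
Unset Strict Implicit.
Unset Printing Implicit Defensive.
Import GRing.Theory.

(** * Lists of labels *)

Definition enumerates (L : seq int) (B : pred int) : Prop := uniq L /\ L =i B.

Definition plus_minus (s : seq nat) : seq int := flatten [seq [:: t%:Z; - t%:Z]%R | t <- s].

Lemma plus_minus_cat s t : plus_minus (s ++ t) = plus_minus s ++ plus_minus t.
Proof. by rewrite /plus_minus map_cat flatten_cat. Qed.

Lemma size_plus_minus s : size (plus_minus s) = (size s).*2.
Proof. by elim: s => //= t s ->. Qed.

Lemma sum_plus_minus s : (\sum_(z <- plus_minus s) z = 0)%R.
Proof.
by elim: s => [|t s IH]; rewrite /= ?big_nil // !big_cons IH addr0 subrr.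
Qed.

Lemma mem_plus_minus s z : (z \in plus_minus s) = (`|z|%N \in s).
Proof. by elim: s => //= t s IH; rewrite !inE IH orbA; congr (_ || _); lia. Qed.

Lemma uniq_plus_minus s : uniq (0 :: s) -> uniq (plus_minus s).
Proof.
elim: s => //= t s IH; rewrite !inE negb_or -!andbA => /and4P[t0 s0 ts us].
rewrite -!/(plus_minus _) !mem_plus_minus abszN absz_nat IH ?s0 ?us // (negbTE ts) orbF !andbT.
by lia.
Qed.

Lemma uniq_iota1 m : uniq (0 :: iota 1 m).
Proof. exact: (iota_uniq 0 m.+1). Qed.

Lemma labels_plus_minus_odd m : enumerates (0%R :: plus_minus (iota 1 m)) (labels m.*2.+1).
Proof.
split=> [|z]; first by rewrite /= uniq_plus_minus ?uniq_iota1 // mem_plus_minus mem_iota.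
by rewrite inE mem_plus_minus mem_iota [RHS]unfold_in /=; lia.
Qed.

Lemma labels_plus_minus_even m : enumerates (plus_minus (iota 1 m)) (labels m.*2).
Proof.
split=> [|z]; first by rewrite uniq_plus_minus ?uniq_iota1.
by rewrite mem_plus_minus mem_iota [RHS]unfold_in /=; lia.
Qed.

(** Two lists are permutations of each other when each predicate [P] has equal counts on both.
    Abstracting the 0-1 values of [P] leaves a linear identity. *)
Ltac count_lia P :=
  repeat match goal with
  | H : context [nat_of_bool (P ?x)] |- _ => move: H
  end;
  repeat match goal with
  | |- context [nat_of_bool (P ?x)] => generalize (nat_of_bool (P x))
  end; lia.

Definition sumz (L : seq int) : int := (\sum_(z <- L) z)%R.

(* The data of a super edge-graceful labeling of the caterpillar with spine
   x - c - y, where c, x and y have j, a and b leaves: the labels ex and ey of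
   the edges cx and cy, then those of the pendant edges at c, x and y. *)
Definition label_lists (j a b : nat) : Prop :=
  exists (ex ey : int) (LJ LA LB : seq int),
  [/\ size LJ = j, size LA = a, size LB = b,
      enumerates (ex :: ey :: LJ ++ LA ++ LB) (labels (j + a + b).+2)
    & enumerates [:: ex + ey + sumz LJ, ex + sumz LA, ey + sumz LB
                  & LJ ++ LA ++ LB]%R (labels (j + a + b).+3)].

Lemma enumerates_perm L L' B : perm_eq L L' -> enumerates L B -> enumerates L' B.
Proof.
move=> LL' [uL memL]; split; first by rewrite -(perm_uniq LL').
by move=> z; rewrite -(perm_mem LL').
Qed.

Lemma label_listsC j a b : label_lists j a b -> label_lists j b a.
Proof.
move=> [ex [ey [LJ [LA [LB [sJ sA sB E V]]]]]].
exists ey, ex, LJ, LB, LA; rewrite -addnAC; split=> //.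
  apply: enumerates_perm E; apply/permP => P /=.
  by rewrite !count_cat; lia.
have -> : (ey + ex = ex + ey)%R by rewrite addrC.
apply: enumerates_perm V; apply/permP => P /=.
by rewrite !count_cat; count_lia P.
Qed.

(* The edge cx gets 0 and cy gets e; the labels left over by the core go by
   opposite pairs to the three sets of leaves, which changes no vertex sum. *)
Lemma label_lists_core (e : int) (cJ cA cB : seq int) (t j a b : nat)
    (m := (t + (j + a + b)).+1) :
    perm_eq (e :: cJ ++ cA ++ cB) (plus_minus (m :: iota 1 t)) ->
    perm_eq [:: e + sumz cJ; sumz cA; e + sumz cB]%R [:: e; m.+1%:Z; - m.+1%:Z]%R ->
  label_lists (size cJ + j.*2) (size cA + a.*2) (size cB + b.*2).
Proof.
move=> pE pV.
pose s := t.+1.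
exists 0%R, e, (cJ ++ plus_minus (iota s j)), (cA ++ plus_minus (iota (s + j) a)),
  (cB ++ plus_minus (iota (s + j + a) b)).
have sum_pad (c : seq int) u : sumz (c ++ plus_minus u) = sumz c.
  by rewrite /sumz big_cat /= sum_plus_minus addr0.
have sz : size cJ + j.*2 + (size cA + a.*2) + (size cB + b.*2) = m.*2.-1.
  have := perm_size pE; rewrite size_plus_minus /= !size_cat size_iota /m; lia.
(* The absolute values t + 1, ..., m - 1 outside the core are cut into consecutive blocks of j, a
   and b numbers, each used with both signs. *)
have iota_m : iota 1 m.+1 =
    iota 1 t ++ iota s j ++ iota (s + j) a ++ iota (s + j + a) b ++ [:: m; m.+1].
  have -> : m.+1 = t + (j + (a + (b + 2))) by rewrite /m; lia.
  rewrite !iotaD !add1n -/s /=.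
  by do !congr (_ ++ _); congr [:: _; _]; rewrite /m /s; lia.
have iota_m' : iota 1 m =
    iota 1 t ++ iota s j ++ iota (s + j) a ++ iota (s + j + a) b ++ [:: m].
  have -> : m = t + (j + (a + (b + 1))) by rewrite /m; lia.
  by rewrite !iotaD !add1n -/s /=; do !congr (_ ++ _); congr [:: _]; rewrite /m /s; lia.
rewrite !size_cat !size_plus_minus !size_iota; split=> //; rewrite sz.
  have -> : m.*2.-1.+2 = m.*2.+1 by rewrite /m; lia.
  apply: enumerates_perm (labels_plus_minus_odd m); rewrite iota_m'.
  apply/permP => P; have /permP/(_ P) := pE.
  rewrite -[m :: _]cat1s !plus_minus_cat /= !count_cat /=; count_lia P.
have -> : m.*2.-1.+3 = m.+1.*2 by rewrite /m; lia.
(* By [pV] the spine sums are e, m + 1 and -(m + 1); by [pE], e and the leaf labels together are all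
   nonzero labels up to m. *)
apply: enumerates_perm (labels_plus_minus_even m.+1); rewrite iota_m !sum_pad !add0r.
apply/permP => P; have /permP/(_ P) := pE; have /permP/(_ P) := pV.
rewrite -[m :: _]cat1s !plus_minus_cat /= !count_cat /=; count_lia P.
Qed.

(** Arguments of [P] that are one integer written differently are merged before the values of [P]
    are abstracted. *)
Ltac perm_eq_int :=
  let P := fresh "P" in
  apply/permP => P /=; rewrite ?addr0 ?addrA;
  repeat match goal with
  | |- context [nat_of_bool (P ?x)] =>
      let n := fresh "n" in set n := nat_of_bool (P x);
      repeat match goal with
      | |- context [nat_of_bool (P ?y)] =>
        have -> : nat_of_bool (P y) = n by rewrite /n; congr (nat_of_bool (P _)); lia
      end; move: n => n
  end; lia.

(** In this construction and the next three, [j], [a], [b] count the pairs added to a core. Here the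
    sums at c, x, y are -1, m + 1, -(m + 1). *)
Lemma label_lists_one_odd_end j a b : label_lists j.*2 a.*2.+2 b.*2.+1.
Proof.
pose m := (1 + (j + a + b)).+1.
have := @label_lists_core (-1)%R [::] [:: m%:Z; 1]%R [:: - m%:Z]%R 1 j a b.
rewrite /= add0n add1n add2n /sumz !big_cons !big_nil -/m.
by apply; perm_eq_int.
Qed.

(** Moving -m to a leaf of c exchanges the sums at c and y. *)
Lemma label_lists_odd_center j a b : label_lists j.*2.+1 a.*2.+2 b.*2.
Proof.
pose m := (1 + (j + a + b)).+1.
have := @label_lists_core (-1)%R [:: - m%:Z]%R [:: m%:Z; 1]%R [::] 1 j a b.
rewrite /= add0n add1n add2n /sumz !big_cons !big_nil -/m.
by apply; perm_eq_int.
Qed.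

(** Since 1 + 2 - 3 = 0 and -2 + 3 = 1, the sums are those for one odd end. *)
Lemma label_lists_all_odd_center j a b : label_lists j.*2.+3 a.*2.+3 b.*2.+1.
Proof.
pose m := (3 + (j + a + b)).+1.
have := @label_lists_core (-1)%R [:: 1; 2; -3]%R [:: m%:Z; -2; 3]%R [:: - m%:Z]%R 3 j a b.
rewrite /= add1n !add3n /sumz !big_cons !big_nil -/m.
by apply; perm_eq_int.
Qed.

Lemma label_lists_all_odd_ends j a b : label_lists j.*2.+1 a.*2.+3 b.*2.+3.
Proof.
pose m := (3 + (j + a + b)).+1.
have := @label_lists_core (-1)%R [:: - m%:Z]%R [:: m%:Z; -2; 3]%R [:: 1; 2; -3]%R 3 j a b.
rewrite /= add1n !add3n /sumz !big_cons !big_nil -/m.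
by apply; perm_eq_int.
Qed.

(** An odd sum has one or three odd terms. With one, some end is even and positive, so it has the
    two leaves that receive m and 1; [label_listsC] moves it to x if necessary. *)
Lemma label_lists_exist j a b : odd (j + a + b) -> 0 < a -> 0 < b ->
  ~ [/\ odd j, odd a, odd b & [|| (a == 1) && (b == 1), (j == 1) && (a == 1) | (j == 1) && (b == 1)]] ->
  label_lists j a b.
Proof.
have half n : n = if odd n then n./2.*2.+1 else n./2.*2.
  by rewrite -{1}[n]odd_double_half; case: odd.
have half2 n : 0 < n -> ~~ odd n -> n = (n./2.-1).*2.+2 by lia.
have half3 n : 1 < n -> odd n -> n = (n./2.-1).*2.+3 by lia.
move=> o a0 b0 exc.
case oa : (odd a); case ob : (odd b); last 1 first.
- have oj : odd j by lia.
  rewrite (half j) oj (half2 a) ?oa // (half b) ob; exact: label_lists_odd_center.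
- have oj : odd j by lia.
  (* Outside the exceptions at most one of the three odd numbers is 1. *)
  have : [|| (1 < a) && (1 < b), (1 < a) && (1 < j) | (1 < b) && (1 < j)].
    apply/negP => /negP H; apply: exc; split=> //; lia.
  case/or3P => /andP[h1 h2].
  + by rewrite (half j) oj (half3 a) // (half3 b) //; apply: label_lists_all_odd_ends.
  + by rewrite (half3 j) // (half3 a) // (half b) ob; apply: label_lists_all_odd_center.
  + apply: label_listsC.
    by rewrite (half3 j) // (half3 b) // (half a) oa; apply: label_lists_all_odd_center.
- have oj : odd j = false by lia.
  apply: label_listsC.
  by rewrite (half j) oj (half2 b) ?ob // (half a) oa; apply: label_lists_one_odd_end.
- have oj : odd j = false by lia.
  by rewrite (half j) oj (half2 a) ?oa // (half b) ob; apply: label_lists_one_odd_end.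
Qed.

Lemma label_lists_impossible j b : odd j -> odd b -> j = 1 \/ b = 1 ->
  ~ label_lists j 1 b.
Proof.
move=> oj ob jb [ex [ey [LJ [LA [LB [sJ sA sB [uE E] [uV V]]]]]]].
case: LA sA uE E uV V => [|α []] //= _ uE E uV V.
pose m := (j + 1 + b).+2./2.
have bE z : z \in [:: ex, ey & LJ ++ α :: LB] -> `|z|%N <= m.
  by rewrite E [_ \in _]unfold_in /= => /andP[].
have E0 : 0%R \in [:: ex, ey & LJ ++ α :: LB].
  by rewrite E [_ \in _]unfold_in /=; lia.
have inV z : `|z|%N <= m.+1 -> z != 0%R ->
    z \in [:: ex + ey + sumz LJ, ex + sumz [:: α], ey + sumz LB & LJ ++ α :: LB]%R.
  by rewrite V [_ \in _]unfold_in /= => zm ->; rewrite orbT andbT; lia.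
(* The number of vertices is even, so 0 labels no vertex, hence no leaf. *)
have: 0%R \notin [:: ex + ey + sumz LJ, ex + sumz [:: α], ey + sumz LB & LJ ++ α :: LB]%R.
  by rewrite V [_ \in _]unfold_in /=; lia.
rewrite !inE !negb_or => /and4P[_ _ _ V0].
have sum1 (z : int) : sumz [:: z] = z by rewrite /sumz big_seq1.
move: E0; rewrite !inE (negbTE V0) orbF => /orP[/eqP ex0|/eqP ey0].
  move: uV; rewrite -ex0 sum1 !add0r /= => /and3P[_ + _].
  by rewrite inE mem_cat mem_head !orbT.
case: jb => [j1|b1]; last first.
  case: LB sB {uE E V bE inV V0} uV => [|β [|? ?]] /=; rewrite ?b1 // => _.
  rewrite -ey0 !sum1 add0r => /and4P[_ _ + _].
  by rewrite mem_cat !inE eqxx !orbT.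
case: LJ sJ uE E uV V bE inV V0 => [|γ [|? ?]] /=; rewrite j1 // => _.
rewrite -ey0 !sum1 addr0 add0r !inE => /and5P[ex_notin _ _ _ _] _ _ _ bE inV.
rewrite !negb_or => /and3P[γ0 α0 _].
move: ex_notin; rewrite !negb_or => /and4P[ex0 exγ exα exLB].
have bex : `|ex|%N <= m by apply: bE; rewrite !inE eqxx.
have bγ : `|γ|%N <= m by apply: bE; rewrite !inE eqxx !orbT.
have bα : `|α|%N <= m by apply: bE; rewrite !inE eqxx !orbT.
have bB z : z \in LB -> `|z|%N <= m.
  by move=> zB; apply: bE; rewrite !inE zB !orbT.
(* The nonzero edge label [ex] must also label a vertex. It differs from all leaf labels, and α, γ
   are nonzero, so this vertex is y. *)
have exB : ex = sumz LB.
  have := inV ex; rewrite !inE (negbTE exLB) (negbTE exα) (negbTE exγ) !orbF.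
  by lia.
have big z : `|z|%N = m.+1 -> z = (ex + γ)%R \/ z = (ex + α)%R.
  move=> zm; have zB : z \notin LB by apply/negP => /bB; lia.
  have := inV z; rewrite !inE -exB (negbTE zB) orbF; lia.
have := big m.+1%:Z%R; have := big (- m.+1%:Z)%R; lia.
Qed.

(** * Labelings of rooted trees *)

Section Rooted.
Variables (G : sgraph) (c : G) (par : G -> G) (depth : G -> nat).
Hypothesis adjE : forall u v : G,
  adj u v = (u != c) && (par u == v) || (v != c) && (par v == u).
Hypothesis depth_par : forall v, v != c -> depth (par v) < depth v.

(** Naming each edge by its end farther from the root turns an edge labeling into a function on the
    vertices other than [c]. *)
Let edge v := [set v; par v].

Lemma par_asym u v : u != c -> v != c -> par u = v -> par v <> u.
Proof.
move=> uc vc uv vu; have := depth_par uc; have := depth_par vc.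
by rewrite uv vu => /ltn_trans/[apply]; rewrite ltnn.
Qed.

Lemma edge_inj : {in [set~ c] &, injective edge}.
Proof.
move=> u v; rewrite !inE => uc vc euv.
have: u \in edge v by rewrite -euv !inE eqxx.
have: v \in edge u by rewrite euv !inE eqxx.
rewrite !inE => /orP[/eqP//|/eqP vu] /orP[/eqP//|/eqP uv].
by case: (par_asym uc vc).
Qed.

Lemma edges_rooted : edges G = edge @: [set~ c].
Proof.
apply/setP=> E; rewrite inE; apply/existsP/imsetP => [[u /existsP[v]]|[v]].
  rewrite adjE => /andP[/orP[] /andP[uc /eqP<-] /eqP->].
    by exists u; rewrite ?inE.
  by exists v; rewrite ?inE // setUC.
rewrite !inE => vc ->; exists v; apply/existsP; exists (par v).
by rewrite adjE vc !eqxx.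
Qed.

Lemma card_edges_rooted : #|edges G| = #|G|.-1.
Proof. by rewrite edges_rooted card_in_imset ?cardsC1 //; apply: edge_inj. Qed.

Definition vertex_sum (g : G -> int) (v : G) : int :=
  ((if v == c then 0 else g v) + \sum_(u | (u != c) && (par u == v)) g u)%R.

Lemma induced_label_rooted (f : {set G} -> int) v :
  induced_label f v = vertex_sum (f \o edge) v.
Proof.
rewrite /induced_label /vertex_sum.
(* The neighbours of v are its children and, unless v is the root, its parent. *)
rewrite (bigID (fun u => (u != c) && (par u == v))) /= addrC; congr (_ + _)%R.
  case: eqP => [->|/eqP vc].
    by rewrite big1 // => u; rewrite adjE eqxx orbF => /andP[->].
  rewrite (big_pred1 (par v)) /edge 1?setUC // => u /=.
  rewrite adjE vc /= [u == par v]eq_sym.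
  case: (eqVneq (par v) u) => [vu|_]; last by rewrite orbF andbN.
  rewrite orbT /=; apply/negP => /andP[uc /eqP uv].
  exact: (par_asym vc uc vu uv).
apply: eq_big => [u|u /andP[_ /andP[_ /eqP <-]] //].
by rewrite adjE; case: ((u != c) && _); rewrite ?andbF.
Qed.

Lemma seg_rooted : super_edge_graceful G <-> exists g : G -> int,
  bij_onto (mem [set~ c]) (labels #|G|.-1) g /\
  bij_onto (mem [set: G]) (labels #|G|) (vertex_sum g).
Proof.
rewrite /super_edge_graceful card_edges_rooted.
split=> [[f [[fE fI fS] [vE vI vS]]]|[g [[gE gI gS] [vE vI vS]]]].
  exists (f \o edge); split; split.
  - move=> v vc; apply: fE; rewrite /= edges_rooted; exact: imset_f.
  - move=> u v uc vc /= /fI; rewrite edges_rooted => euv.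
    by apply: edge_inj => //; apply: euv; apply: imset_f.
  - move=> y /fS[E]; rewrite /= edges_rooted => /imsetP[v vc ->] <-.
    by exists v.
  - by move=> v /vE; rewrite induced_label_rooted.
  - by move=> u v uT vT; rewrite -!(induced_label_rooted f); exact: (vI u v uT vT).
  - by move=> y /vS[v vT <-]; exists v; rewrite /= -?(induced_label_rooted f).
(* The default 0 only concerns sets that are not edges. *)
pose f E := if [pick v in [set~ c] | edge v == E] is Some v then g v else 0%R.
have fg v : v != c -> f (edge v) = g v.
  move=> vc; rewrite /f; case: pickP => [u /andP[uc /eqP /edge_inj -> //]|].
    by rewrite !inE.
  by move/(_ v); rewrite !inE vc eqxx.
have fv v : induced_label f v = vertex_sum g v.
  rewrite induced_label_rooted /vertex_sum; congr (_ + _)%R.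
    by case: eqP => // /eqP /fg.
  by apply: eq_bigr => u /andP[/fg].
have fg' v : v \in [set~ c] -> f (edge v) = g v by rewrite !inE; apply: fg.
exists f; split; split.
- rewrite /= edges_rooted => _ /imsetP[v vc ->]; rewrite fg'//; exact: gE.
- rewrite /= edges_rooted => _ _ /imsetP[u uc ->] /imsetP[v vc ->].
  by rewrite !fg' // => /gI ->.
- move=> y /gS[v vc <-]; exists (edge v); last exact: fg'.
  by rewrite /= edges_rooted; apply: imset_f.
- by move=> v /vE; rewrite fv.
- by move=> u v uT vT; rewrite !fv; apply: vI.
- by move=> y /vS[v vT <-]; exists v; rewrite ?fv.
Qed.

End Rooted.

(** * Codes of vertices, and labelings as lists *)

Lemma bij_onto_enumerates (T : finType) (A : {pred T}) (s : seq T) (B : pred int)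
    (g : T -> int) : uniq s -> s =i A ->
  bij_onto A B g <-> enumerates (map g s) B.
Proof.
move=> us sA; split=> [[gE gI gS]|[ug gB]].
  split.
    by rewrite map_inj_in_uniq // => u v; rewrite !sA; apply: gI.
  move=> y; apply/mapP/idP => [[v]|/gS[v vA <-]]; last by exists v; rewrite ?sA.
  by rewrite sA => /gE vB ->.
split.
- by move=> v; rewrite -sA => vs; have := gB (g v); rewrite map_f.
- move=> u v; rewrite -!sA; elim: s ug {us sA gB} => //= w s IH /andP[ws us].
  rewrite !inE => /orP[/eqP->|us'] /orP[/eqP->|vs'] // guv.
  + by rewrite guv map_f in ws.
  + by rewrite -guv map_f in ws.
  + exact: IH.
- by move=> y; rewrite -gB => /mapP[v]; rewrite sA => vA ->; exists v.
Qed.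

Lemma map_interpolation (T : eqType) (U : Type) (s : seq T) (l : seq U) (y0 : U) :
  uniq s -> size s = size l -> exists g : T -> U, map g s = l.
Proof.
move=> us sl; exists (fun v => nth y0 l (index v s)).
case: s us sl => [|v0 s] us sl; first by case: l sl.
apply: (@eq_from_nth _ y0); rewrite ?size_map // => i ilt.
by rewrite (nth_map v0) // index_uniq.
Qed.

(* A vertex of a caterpillar is coded by a flag telling whether it is a leaf and
   the position on the spine of the vertex itself (of its neighbour, for a leaf). *)
Definition code_adj (x y : bool * nat) : bool :=
  match x.1, y.1 with
  | false, false => (x.2.+1 == y.2) || (y.2.+1 == x.2)
  | true, true => false
  | _, _ => x.2 == y.2
  end.

(** Spine positions 0, 1, 2 stand for x, c, y; the root c comes first. *)
Definition codes (j a b : nat) : seq (bool * nat) :=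
  [:: (false, 1), (false, 0), (false, 2)
    & nseq j (true, 1) ++ nseq a (true, 0) ++ nseq b (true, 2)].

(** Leaves at the same spine vertex share a code; the permutation fixes their number. *)
Definition coded (G : sgraph) (j a b : nat) : Prop :=
  exists k : G -> bool * nat,
    (forall u v, adj u v = code_adj (k u) (k v)) /\
    perm_eq [seq k v | v <- enum G] (codes j a b).

Lemma perm_map_lift (T U : eqType) (k : T -> U) (s : seq T) (l : seq U) :
  perm_eq (map k s) l -> exists2 t, perm_eq s t & map k t = l.
Proof.
elim: l s => [|y l IH] s pl.
  by exists [::] => //; case: s pl => // v s /perm_size.
have /mapP[v vs yv] : y \in map k s by rewrite (perm_mem pl) mem_head.
have srem := perm_to_rem vs.
have [t rt kt] : exists2 t, perm_eq (rem v s) t & map k t = l.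
  apply: IH; rewrite -(perm_cons y) -(perm_rot 0) rot0 yv -map_cons.
  by rewrite -(permPl (perm_map k srem)) -yv.
by exists (v :: t); rewrite /= ?kt ?yv // (permPl srem) perm_cons.
Qed.

Lemma map_eq_cat (T U : Type) (k : T -> U) (s : seq T) (l1 l2 : seq U) :
  map k s = l1 ++ l2 ->
  exists s1 s2, [/\ s = s1 ++ s2, map k s1 = l1 & map k s2 = l2].
Proof.
move=> ks; exists (take (size l1) s), (drop (size l1) s).
by rewrite cat_take_drop map_take map_drop ks take_size_cat // drop_size_cat.
Qed.

Lemma coded_enum (G : sgraph) (j a b : nat) (k : G -> bool * nat) :
    perm_eq [seq k v | v <- enum G] (codes j a b) ->
  exists c x y sJ sA sB,
    [/\ perm_eq (enum G) [:: c, x, y & sJ ++ sA ++ sB],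
        [/\ k c = (false, 1), k x = (false, 0) & k y = (false, 2)],
        map k sJ = nseq j (true, 1), map k sA = nseq a (true, 0)
      & map k sB = nseq b (true, 2)].
Proof.
move=> /perm_map_lift[[|c [|x [|y r]]] // tE [kc kx ky]].
move=> /map_eq_cat[sJ [s [rE kJ /map_eq_cat[sA [sB [sE kA kB]]]]]].
by exists c, x, y, sJ, sA, sB; split=> //; rewrite -sE -rE.
Qed.

Lemma coded_card (G : sgraph) (j a b : nat) : coded G j a b -> #|G| = (j + a + b).+3.
Proof.
move=> [k [_ /perm_size]].
by rewrite size_map -cardT /= !size_cat !size_nseq addnA.
Qed.

(** The tree is rooted at c, where the value is a dummy. *)
Definition code_parent (x : bool * nat) : bool * nat :=
  if x.1 then (false, x.2) else (false, 1).

(** A leaf of c gets 2 although it is at depth 1; what matters is the decrease towards the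
    parent. *)
Definition code_depth (x : bool * nat) : nat :=
  if x.1 then 2 else x.2 != 1.

Definition code_range : seq (bool * nat) :=
  [:: (false, 1); (false, 0); (false, 2); (true, 1); (true, 0); (true, 2)].

Lemma codes_range (j a b : nat) : {subset codes j a b <= code_range}.
Proof.
move=> x; rewrite !inE !mem_cat !mem_nseq.
move=> /orP[->//|/orP[->|/orP[->|]]]; rewrite ?orbT //.
by case/or3P => /andP[_ ->]; rewrite ?orbT.
Qed.

(** Only six codes occur, so a boolean claim about all of them is settled by evaluation. *)
Lemma all_code_range (P : pred (bool * nat)) :
  all P code_range -> forall x, x \in code_range -> P x.
Proof. by move/allP. Qed.

Lemma sum_map_nseq (T : Type) (K : eqType) (k : T -> K) (s : seq T) n x
    (Q : pred K) (g : T -> int) : map k s = nseq n x ->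
  (\sum_(u <- s | Q (k u)) g u = if Q x then \sum_(u <- s) g u else 0)%R.
Proof.
elim: s n => [|u s IH] [|n] //=; first by rewrite !big_nil if_same.
by case=> ku /IH; rewrite !big_cons ku => ->; case: (Q x).
Qed.

Section Coded.
Variables (G : sgraph) (j a b : nat) (k : G -> bool * nat).
Hypothesis adj_k : forall u v, adj u v = code_adj (k u) (k v).
Hypothesis codes_k : perm_eq [seq k v | v <- enum G] (codes j a b).

Lemma mem_code_range v : k v \in code_range.
Proof. by apply: (@codes_range j a b); rewrite -(perm_mem codes_k) map_f // mem_enum. Qed.

(** With root c, the labels of the other vertices form the edge list, and the vertex sums involve
    the leaves only through the totals over [sJ], [sA], [sB]. *)
Lemma seg_label_lists_of_code :
  #|edges G| = (j + a + b).+2 /\ (super_edge_graceful G <-> label_lists j a b).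
Proof.
have [c [x [y [sJ [sA [sB [tE [kc kx ky] kJ kA kB]]]]]]] := coded_enum codes_k.
set t := [:: c, x, y & _] in tE.
have ut : uniq t by rewrite -(perm_uniq tE) enum_uniq.
have memt v : v \in t by rewrite -(perm_mem tE) mem_enum.
have cardG : #|G| = (j + a + b).+3 by apply: coded_card; exists k.
(* Each spine code occurs once in [codes], so it identifies its vertex. *)
have code_inj w v : k w \in [:: (false, 1); (false, 0); (false, 2)] ->
    (w == v) = (k v == k w).
  move=> kw; apply/eqP/eqP => [-> //|kvw].
  have count1 : count_mem (k w) (map k (enum G)) = 1.
    rewrite (permP codes_k) /= !count_cat !count_nseq.
    by move: kw; rewrite !inE => /or3P[] /eqP -> /=.
  move: count1; rewrite count_map => count1.
  have : ~~ (1 < size [seq u <- enum G | preim k (pred1 (k w)) u]) by rewrite size_filter count1.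
  apply: contraNeq => wv.
  apply: (@uniq_leq_size _ [:: w; v]); first by rewrite /= inE wv.
  by move=> u; rewrite !inE mem_filter mem_enum andbT => /orP[] /eqP -> /=; apply/eqP.
pose par v := match k v with
  | (true, 0) => x | (true, 2) => y | _ => c end.
have k_par v : k (par v) = code_parent (k v).
  have := mem_code_range v; rewrite /par !inE.
  by do ![case/orP|move/eqP->]; rewrite // => /eqP->.
have par_eq u v : (par u == v) = (k v == code_parent (k u)).
  rewrite code_inj k_par //; move: (k u) (mem_code_range u).
  exact: all_code_range.
have c_eq v : (v == c) = (k v == (false, 1)).
  by rewrite eq_sym code_inj kc.
have adjE u v : adj u v = (u != c) && (par u == v) || (v != c) && (par v == u).
  rewrite adj_k !par_eq !c_eq; move: (k u) (k v) (mem_code_range u) (mem_code_range v).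
  move=> p q Hp Hq; apply/eqP; move: q Hq; apply: all_code_range.
  by move: p Hp; apply: all_code_range.
have depth_par v : v != c -> code_depth (k (par v)) < code_depth (k v).
  rewrite k_par c_eq; apply/implyP; move: (k v) (mem_code_range v).
  exact: all_code_range.
have vsum g v : vertex_sum c par g v =
    ((if k v == (false, 1) then 0 else g v) +
      \sum_(u <- t | (k u != (false, 1)) && (k v == code_parent (k u))) g u)%R.
  rewrite /vertex_sum c_eq -(perm_big _ tE) big_enum_cond /=; congr (_ + _)%R.
  by apply: eq_bigl => u; rewrite c_eq par_eq.
(* A condition on codes keeps or drops each spine vertex and each set of leaves as a whole. *)
have tsum (g : G -> int) (Q : pred (bool * nat)) : (\sum_(u <- t | Q (k u)) g u =
    (if Q (false, 1) then g c else 0) + ((if Q (false, 0) then g x else 0) +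
    ((if Q (false, 2) then g y else 0) + ((if Q (true, 1) then sumz (map g sJ) else 0) +
    ((if Q (true, 0) then sumz (map g sA) else 0) +
     (if Q (true, 2) then sumz (map g sB) else 0))))))%R.
  rewrite !big_cons !big_cat /= (sum_map_nseq _ _ kJ) (sum_map_nseq _ _ kA).
  rewrite (sum_map_nseq _ _ kB) kc kx ky /sumz !big_map.
  by do 3 case: (Q _); rewrite ?add0r.
have vc g : vertex_sum c par g c = (g x + g y + sumz (map g sJ))%R.
  by rewrite vsum (tsum g (fun p => (p != _) && (_ == code_parent p))) kc /= !add0r !addr0 addrA.
have vx g : vertex_sum c par g x = (g x + sumz (map g sA))%R.
  by rewrite vsum (tsum g (fun p => (p != _) && (_ == code_parent p))) kx /= !add0r !addr0.
have vy g : vertex_sum c par g y = (g y + sumz (map g sB))%R.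
  by rewrite vsum (tsum g (fun p => (p != _) && (_ == code_parent p))) ky /= !add0r.
have vleaf g v : v \in sJ ++ sA ++ sB -> vertex_sum c par g v = g v.
  move=> vs; have : k v \in map k (sJ ++ sA ++ sB) by apply: map_f.
  rewrite !map_cat kJ kA kB !mem_cat !mem_nseq vsum.
  rewrite (tsum g (fun p => (p != _) && (_ == code_parent p))).
  by case/or3P => /andP[_ /eqP->]; rewrite /= !addr0.
have mapE g : map g (behead t) = [:: g x, g y & map g sJ ++ map g sA ++ map g sB].
  by rewrite /= !map_cat.
have mapV g : map (vertex_sum c par g) t = [:: g x + g y + sumz (map g sJ),
    g x + sumz (map g sA), g y + sumz (map g sB) & map g sJ ++ map g sA ++ map g sB]%R.
  by rewrite /= vc vx vy -!map_cat; do 3 congr (_ :: _); apply/eq_in_map => v; apply: vleaf.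
split; first by rewrite (card_edges_rooted adjE depth_par) cardG.
have ut' : uniq (behead t) by case/andP: ut.
have mem_t' : behead t =i [set~ c].
  move=> v; rewrite !inE; have := memt v; rewrite inE.
  by case: eqP => [->|] // _; apply/negbTE; case/andP: ut.
have mem_t : t =i [set: G] by move=> v; rewrite memt inE.
rewrite (seg_rooted adjE depth_par) cardG; split=> [[g [gE gV]]|].
  exists (g x), (g y), (map g sJ), (map g sA), (map g sB).
  have sz n (s : seq G) p : map k s = nseq n p -> size (map g s) = n.
    by move/(congr1 size); rewrite !size_map size_nseq.
  rewrite (sz _ _ _ kJ) (sz _ _ _ kA) (sz _ _ _ kB); split=> //.
    by rewrite -mapE; apply/(bij_onto_enumerates _ _ ut' mem_t').
  by rewrite -mapV; apply/(bij_onto_enumerates _ _ ut mem_t).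
move=> [ex [ey [LJ [LA [LB [zJ zA zB E V]]]]]].
have sz n (s : seq G) p : map k s = nseq n p -> size s = n.
  by move/(congr1 size); rewrite size_map size_nseq.
(* Conversely, the lists of labels are laid out along the vertices other than c. *)
have [|g gt] := @map_interpolation _ _ (behead t) [:: ex, ey & LJ ++ LA ++ LB] 0%R ut'.
  by rewrite /= !size_cat zJ zA zB (sz _ _ _ kJ) (sz _ _ _ kA) (sz _ _ _ kB).
exists g; split.
  by apply/(bij_onto_enumerates _ _ ut' mem_t'); rewrite gt.
apply/(bij_onto_enumerates _ _ ut mem_t); rewrite mapV.
move: gt; rewrite mapE => -[-> -> /eqP].
rewrite eqseq_cat ?size_map ?zJ ?(sz _ _ _ kJ) // => /andP[/eqP-> /eqP].
by move/eqP; rewrite eqseq_cat ?size_map ?zA ?(sz _ _ _ kA) // => /andP[/eqP-> /eqP->].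
Qed.
End Coded.

(** Adjacency depends only on codes, so it suffices to list both vertex sets in the order of [codes]
    and match the entries. *)
Lemma coded_isomorphic (G H : sgraph) (j a b : nat) :
  coded G j a b -> coded H j a b -> isomorphic G H.
Proof.
move=> [k [adj_k /perm_map_lift[s sE sk]]] [l [adj_l /perm_map_lift[t tE tl]]].
have us : uniq s by rewrite -(perm_uniq sE) enum_uniq.
have ut : uniq t by rewrite -(perm_uniq tE) enum_uniq.
have mem_s v : v \in s by rewrite -(perm_mem sE) mem_enum.
have mem_t v : v \in t by rewrite -(perm_mem tE) mem_enum.
have st : size s = size t by rewrite -(size_map k) sk -tl size_map.
have [v0 s0] : exists v0, v0 \in s by case: (s) sk => // v0; exists v0; rewrite mem_head.
have [w0 t0] : exists w0, w0 \in t by case: (t) tl => // w0; exists w0; rewrite mem_head.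
pose f v := nth w0 t (index v s); pose f' w := nth v0 s (index w t).
have lf v : l (f v) = k v.
  rewrite -(nth_map w0 (l w0)) -?st ?index_mem // tl -sk.
  by rewrite (nth_map v0) ?index_mem // nth_index.
exists f; last by move=> u v; rewrite adj_l !lf adj_k.
exists f' => v; rewrite /f /f'.
  by rewrite index_uniq -?st ?index_mem // nth_index.
by rewrite index_uniq ?st ?index_mem // nth_index.
Qed.

(** Position i becomes 2 - i, which reflects the spine. *)
Lemma codedC (G : sgraph) (j a b : nat) : coded G j a b -> coded G j b a.
Proof.
move=> [k [adj_k codes_k]]; exists (fun v => ((k v).1, 2 - (k v).2)); split.
  move=> u v; rewrite adj_k.
  move: (k u) (k v) (mem_code_range codes_k u) (mem_code_range codes_k v).
  move=> p q Hp Hq; apply/eqP; move: q Hq; apply: all_code_range.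
  by move: p Hp; apply: all_code_range.
rewrite (map_comp (fun p => (p.1, 2 - p.2))).
rewrite (permPl (perm_map _ codes_k)); apply/permP => P.
rewrite /= !map_cat !map_nseq /= -![2 - 0]/2 -![2 - 1]/1 -![2 - 2]/0.
by rewrite !count_cat; count_lia P.
Qed.

(** * The trees RT(0^j, 1, a) *)

(** Serves to count the vertices of each code. *)
Lemma sum_RT_vertex (s : seq nat) (F : RT_vertex s -> nat) :
  \sum_x F x = F None + \sum_(i < size s)
    (F (Some (existT _ i None)) + \sum_(k < nth 0 s i) F (Some (existT _ i (Some k)))).
Proof.
have sum_option (T : finType) (f : option T -> nat) : \sum_x f x = f None + \sum_x f (Some x).
  rewrite (bigD1 None) //= (reindex_omap Some id) => [|[]//]; congr (_ + _).
  by apply: eq_bigl => x /=; rewrite eqxx.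
rewrite sum_option; congr (_ + _).
transitivity (\sum_(i < size s) \sum_(o : option 'I_(nth 0 s i)) F (Some (existT _ i o))).
  by rewrite sig_big_dep /=; apply: eq_bigr => -[].
by apply: eq_bigr => i _; rewrite (sum_option _ (fun o => F (Some (existT _ i o)))).
Qed.

(** Children with index below j are the leaves of c; index j is x, which has one leaf, and j + 1 is
    y. *)
Definition child_code (j i : nat) : bool * nat :=
  if i < j then (true, 1) else (false, if i == j then 0 else 2).

Definition grandchild_code (j i : nat) : bool * nat :=
  (true, if i == j then 0 else 2).

Lemma code_adjC x y : code_adj x y = code_adj y x.
Proof. by case: x y => [[] i] [[] i']; rewrite /code_adj /= 1?orbC 1?eq_sym. Qed.

Lemma code_adj_root_child j i : code_adj (false, 1) (child_code j i).
Proof. by rewrite /child_code; case: ltnP => //; case: eqP. Qed.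

Lemma code_adj_child_child j i i' :
  code_adj (child_code j i) (child_code j i') = false.
Proof.
by rewrite /child_code; do 2 case: ltnP => _ //; do ?case: eqP.
Qed.

Lemma code_adj_child_grandchild j i i' : i <= j.+1 -> j <= i' <= j.+1 ->
  code_adj (child_code j i) (grandchild_code j i') = (i == i').
Proof.
rewrite /child_code /grandchild_code /code_adj => ij i'j.
case: ltnP => /= lij; first by lia.
by case: (eqVneq i j); case: (eqVneq i' j) => /=; lia.
Qed.

Definition RT_code (j a : nat) (x : RT (nseq j 0 ++ [:: 1; a])) : bool * nat :=
  match x with
  | None => (false, 1)
  | Some (existT i None) => child_code j i
  | Some (existT i (Some _)) => grandchild_code j i
  end.

Lemma RT_coded (j a : nat) : coded (RT (nseq j 0 ++ [:: 1; a])) j 1 a.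
Proof.
set s := nseq j 0 ++ [:: 1; a].
have size_s : size s = j.+2 by rewrite size_cat size_nseq addn2.
have child (i : 'I_(size s)) : i <= j.+1 by have := ltn_ord i; rewrite {2}size_s.
(* The first j children of the root have no children. *)
have grandchild (i : 'I_(size s)) (k : 'I_(nth 0 s i)) : j <= i <= j.+1.
  rewrite child andbT leqNgt; apply/negP => ij; have := ltn_ord k.
  by rewrite {2}nth_cat size_nseq ij nth_nseq ij.
exists (@RT_code j a); split.
  pose tag_child i : RT s := Some (existT _ i None).
  pose tag_grandchild i k : RT s := Some (existT _ i (Some k)).
  have eq_child i i' : (Some (tag_child i) == Some (tag_child i')) = (i == i' :> nat).
    by apply/eqP/eqP => [[->]|/val_inj->].
  have eq_grandchild i i' k : (Some (tag_child i) == Some (tag_grandchild i' k)) = false.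
    by apply/eqP => /(congr1
      (fun x => if x is Some (Some (existT _ (Some _))) then true else false)).
  move=> [[i [k|]]|] [[i' [k'|]]|] //=; rewrite /adj /= /RT_adj /=.
  - by rewrite !eq_grandchild.
  - rewrite eq_child orbF code_adjC code_adj_child_grandchild 1?eq_sym //.
    exact: grandchild k.
  - by rewrite /code_adj /=; case: ifP.
  - rewrite eq_child code_adj_child_grandchild 1?eq_sym //.
    exact: grandchild k'.
  - by rewrite code_adj_child_child.
  - by rewrite code_adjC code_adj_root_child.
  - by rewrite /code_adj /=; case: ifP.
  - by rewrite code_adj_root_child.
apply/permP => P; rewrite count_map -sum1_count big_enum_cond /= big_mkcond sum_RT_vertex /=.
under eq_bigr do rewrite sum_nat_const card_ord.
rewrite -(big_mkord xpredT (fun i => (if P (child_code j i) then 1 else 0) +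
  nth 0 s i * (if P (grandchild_code j i) then 1 else 0))).
(* Indices j and j + 1 are split off; each earlier one contributes a single leaf of c. *)
rewrite size_s !big_nat_recr //= (eq_big_nat _ _ (F2 := fun=> P (true, 1) : nat)); last first.
  move=> i /= ij; rewrite nth_cat size_nseq ij nth_nseq ij /child_code ij addn0.
  by case: (P _).
rewrite sum_nat_const_nat subn0 !nth_cat size_nseq ltnn ltnNge leqnSn subnn subSnn /=.
rewrite /child_code /grandchild_code ltnn ltnNge leqnSn eqxx (gtn_eqF (ltnSn j)) /=.
rewrite !count_cat !count_nseq /=.
have PE x : (if P x then 1 else 0) = P x by case: (P x).
by rewrite !PE [count _ (nseq a _)]count_nseq; count_lia P.
Qed.

(** * Caterpillars *)

Lemma walkP (G : sgraph) (u v : G) n :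
  reflect (exists p, [/\ path (@adj G) u p, last u p = v & size p = n]) (walk u v n).
Proof.
apply: (iffP existsP) => [[p /andP[pp /eqP lp]]|[p [pp lp /eqP sp]]].
  by exists p; rewrite size_tuple.
by exists (Tuple sp); rewrite /= pp lp eqxx.
Qed.

Lemma dist_le (G : sgraph) (u v : G) n : walk u v n -> dist u v <= n.
Proof.
move=> w; rewrite /dist leqNgt; apply/negP => lt.
have n_lt : n < #|G| by rewrite -[#|G|](size_iota 0); apply: leq_trans lt (find_size _ _).
by have := before_find 0 lt; rewrite nth_iota // w.
Qed.

Lemma connected_uniq_path (G : sgraph) (u v : G) : connected G ->
  exists p, [/\ path (@adj G) u p, last u p = v & uniq (u :: p)].
Proof.
move=> [_ /(_ u v)/connectP[p pp ->]].
by case: (shortenP pp) => q qp uq _; exists q.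
Qed.

(** A simple path has fewer than [#|G|] edges, so [find] succeeds within its range. *)
Lemma walk_dist (G : sgraph) (u v : G) : connected G -> walk u v (dist u v).
Proof.
move=> /(@connected_uniq_path _ u v)[p [pp lp up]].
have wp : walk u v (size p) by apply/walkP; exists p.
have p_lt : size p < #|G| by rewrite -[_ < _]/(size (u :: p) <= _) -(card_uniqP up) max_card.
have h : has (walk u v) (iota 0 #|G|) by apply/hasP; exists (size p); rewrite ?mem_iota.
have := nth_find 0 h; rewrite -/(dist u v) nth_iota //.
by rewrite -[#|G|](size_iota 0) -has_find.
Qed.

Lemma dist_le_diameter (G : sgraph) (u v : G) : dist u v <= diameter G.
Proof.
apply: leq_trans (leq_bigmax u); exact: (leq_bigmax (F := fun w => dist u w)).
Qed.

Lemma diameter_uniq_path (G : sgraph) : connected G ->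
  exists u p, [/\ path (@adj G) u p, uniq (u :: p) & diameter G <= size p].
Proof.
move=> conG; have G0 := conG.1.
have [u du] := eq_bigmax (fun u : G => \max_(v : G) dist u v) G0.
have [v dv] := eq_bigmax (fun v : G => dist u v) G0.
have [p [pp lp up]] := @connected_uniq_path _ u v conG.
exists u, p; split=> //; rewrite /diameter du dv.
by apply: dist_le; apply/walkP; exists p.
Qed.

Lemma degree_gt1 (G : sgraph) (u v w : G) : adj v u -> adj v w -> u != w -> ~~ leaf v.
Proof.
move=> vu vw uw; rewrite /leaf neq_ltn; apply/orP; right.
rewrite -[2](_ : #|[set u; w]| = 2); last by rewrite cards2 uw.
by apply: subset_leq_card; apply/subsetP => z; rewrite !inE => /orP[]/eqP->.
Qed.

Lemma path_interior_nonleaf (G : sgraph) (u v : G) p :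
  path (@adj G) u (v :: p) -> uniq [:: u, v & p] ->
  {in belast v p, forall w, ~~ leaf w}.
Proof.
elim: p u v => //= w p IH u v /and3P[uv vw wp] /andP[u_notin up] x.
rewrite inE => /orP[/eqP->|]; last by apply: (IH v); rewrite /= ?vw.
apply: (@degree_gt1 _ u v w) => //; first by rewrite adj_sym.
by move: u_notin; rewrite !inE !negb_or => /and3P[].
Qed.

Lemma leaf_adj (G : sgraph) (v : G) : leaf v -> exists w, forall u, adj v u = (u == w).
Proof.
by move=> /cards1P[w /setP vw]; exists w => u; have := vw u; rewrite !inE.
Qed.

Lemma path_lipschitz (G : sgraph) (phi : G -> nat) (u : G) p :
  (forall u v, adj u v -> phi v <= (phi u).+1) ->
  path (@adj G) u p -> phi (last u p) <= phi u + size p.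
Proof.
move=> lip; elim: p u => [|v p IH] u /=; first by rewrite addn0.
case/andP=> /lip uv /IH vp; lia.
Qed.

(** The isomorphism gives nonleaves their positions on the spine; a leaf takes that of its only
    neighbour. *)
Lemma caterpillar_code (G : sgraph) : caterpillar G -> 2 < diameter G ->
  exists (n : nat) (k : G -> bool * nat),
  [/\ diameter G <= n.+1, forall v, (k v).1 = leaf v, forall v, (k v).2 < n,
      forall i, i < n -> #|[set v | k v == (false, i)]| = 1
    & forall u v, adj u v = code_adj (k u) (k v)].
Proof.
move=> [[conG _] [n [h bij_h adj_h]]] diam.
have [w0 [p [pp up size_p]]] := diameter_uniq_path conG.
(* Two adjacent leaves would form a whole component, hence all of [G], which contains a simple path
   on at least four vertices. *)
have leaf_leaf (u v : G) : leaf u -> leaf v -> adj u v = false.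
  move=> /leaf_adj[u' uE] /leaf_adj[v' vE]; apply/negP => uv.
  have vu : adj v u by rewrite adj_sym.
  have clos : closed (@adj G) (pred2 u v).
    move=> x y xy; rewrite !inE.
    have Eu : v = u' by apply/eqP; rewrite -uE.
    have Ev : u = v' by apply/eqP; rewrite -vE.
    case: (eqVneq x u) xy => [->|xu]; first by rewrite uE -Eu => /eqP->; rewrite eqxx orbT.
    case: (eqVneq x v) => [->|xv]; first by rewrite vE -Ev => /eqP->; rewrite eqxx.
    rewrite adj_sym => yx; apply/esym/negbTE; rewrite negb_or.
    apply/andP; split; apply: contraTneq yx => ->; first by rewrite uE -Eu.
    by rewrite vE -Ev.
  have all_uv x : x \in [:: u; v].
    by have := closed_connect clos (conG.2 u x); rewrite !inE eqxx.
  have := uniq_leq_size up (s2 := [:: u; v]) (fun x _ => all_uv x).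
  by rewrite /= ltnNge; lia.
pose nonleaf := [pred v : G | ~~ leaf v].
pose pos (v : G) : nat := if insub v is Some x then h (x : {v : G | nonleaf v}) else 0.
have posE v (nv : nonleaf v) : pos v = h (exist _ v nv).
  rewrite /pos; case: insubP => [x _ xv|]; last by rewrite nv.
  by congr (nat_of_ord (h _)); apply: val_inj.
have pos_lt v : nonleaf v -> pos v < n by move=> nv; rewrite posE.
have pos_inj u v : nonleaf u -> nonleaf v -> (pos u == pos v) = (u == v).
  move=> nu nv; rewrite !posE; apply/eqP/eqP => [/val_inj/(bij_inj bij_h)[]//|uv].
  by congr (nat_of_ord (h _)); apply: val_inj.
have pos_adj u v : nonleaf u -> nonleaf v -> adj u v = code_adj (false, pos u) (false, pos v).
  move=> nu nv; rewrite !posE.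
  by have := adj_h (exist _ u nu) (exist _ v nv).
have pos_surj i : i < n -> exists2 v, nonleaf v & pos v = i.
  move=> ilt; have [h' _ h'K] := bij_h; have := h'K (Ordinal ilt).
  case: (h' _) => v nv hv; exists v => //.
  by rewrite posE hv.
pose nbr v : G := odflt v [pick u | adj v u].
have nbrE v u : leaf v -> adj v u = (u == nbr v).
  move=> /leaf_adj[w vE]; rewrite vE /nbr; case: pickP => [x|/(_ w)]; rewrite vE ?eqxx //.
  by move=> /eqP->.
have nbr_nonleaf v : leaf v -> nonleaf (nbr v).
  move=> lv; apply/negP => lw; have := leaf_leaf _ _ lv lw.
  by rewrite nbrE // eqxx.
(* All vertices of a simple path but its two ends lie on the spine. *)
have diam_n : diameter G <= n.+1.
  have card_nonleaf : #|nonleaf| = n by rewrite -card_sig (bij_eq_card bij_h) card_ord.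
  apply: leq_trans size_p _; case: p pp up => //= v p pp up; rewrite ltnS.
  rewrite -card_nonleaf -(size_belast v p).
  rewrite -(card_uniqP (_ : uniq (belast v p))).
    by apply: subset_leq_card; apply/subsetP => w /(path_interior_nonleaf pp up).
  by case/andP: up => _; rewrite -/(uniq (v :: p)) lastI rcons_uniq => /andP[].
exists n, (fun v => (leaf v, pos (if leaf v then nbr v else v))).
have adj_code u v : adj u v = code_adj (leaf u, pos (if leaf u then nbr u else u))
   (leaf v, pos (if leaf v then nbr v else v)).
  case lu : (leaf u); case lv : (leaf v).
  - by rewrite leaf_leaf.
  - by rewrite nbrE // /code_adj /= pos_inj ?nbr_nonleaf /= ?lv // eq_sym.
  - by rewrite adj_sym nbrE // /code_adj /= pos_inj ?nbr_nonleaf /= ?lu.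
  - by rewrite pos_adj //= ?lu ?lv.
split=> //.
- move=> v /=; case: ifP => lv; apply: pos_lt; rewrite ?nbr_nonleaf //= lv //.
- move=> i /pos_surj[v nv vi]; apply/eqP/cards1P; exists v.
  apply/setP => u; rewrite !inE xpair_eqE eqbF_neg.
  case lu : (leaf u) => /=; first by apply/esym; apply: contraNF nv => /eqP <-.
  by rewrite -vi pos_inj //= lu.
Qed.

Section SpineCode.
Variables (G : sgraph) (n : nat) (k : G -> bool * nat).
Hypothesis k_leaf : forall v, (k v).1 = leaf v.
Hypothesis k_lt : forall v, (k v).2 < n.
Hypothesis k_spine : forall i, i < n -> #|[set v | k v == (false, i)]| = 1.
Hypothesis k_adj : forall u v, adj u v = code_adj (k u) (k v).

(** The hypothesis makes i' the only spine neighbour of i. Without a pendant leaf, the spine vertex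
    at i would have degree 1 and be a leaf itself. *)
Lemma spine_end_leaf (i i' : nat) : i < n -> i' < n ->
  (forall m, m < n -> (i.+1 == m) || (m.+1 == i) = (m == i')) ->
  exists v, k v = (true, i).
Proof.
move=> ilt i'lt end_i.
have /eqP/cards1P[z /setP zE] := k_spine ilt.
have kz : k z = (false, i) by apply/eqP; have := zE z; rewrite !inE eqxx.
case: (pickP [pred v | k v == (true, i)]) => [v /eqP|no_leaf]; first by exists v.
have : leaf z.
  rewrite /leaf /degree -(k_spine i'lt); apply/eqP/eq_card => v.
  rewrite !inE k_adj kz; have := k_lt v; have /= := no_leaf v.
  case: (k v) => [[] m] //= ; rewrite /code_adj !xpair_eqE /= ?eqxx /=.
    by move=> mi _; rewrite eq_sym mi.
  by move=> _ /end_i.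
by rewrite -k_leaf kz.
Qed.

(** Leaves at opposite ends of the spine are at distance at least n + 1. *)
Lemma spine_diameter : connected G -> 1 < n -> n < diameter G.
Proof.
move=> conG n1.
have [u ku] : exists v, k v = (true, 0) by apply: (@spine_end_leaf 0 1); lia.
have [v kv] : exists v, k v = (true, n.-1).
  by apply: (@spine_end_leaf n.-1 n.-2); lia.
(* [phi] changes by 1 along each edge and goes from 0 at u to n + 1 at v. *)
pose phi w := let: (l, i) := k w in
  if l then (if i == n.-1 then n.+1 else i) else i.+1.
have lip x y : adj x y -> phi y <= (phi x).+1.
  rewrite k_adj /phi; have := k_lt x; have := k_lt y.
  by case: (k x) (k y) => [[] i] [[] i']; rewrite /code_adj //=; case: (eqVneq i n.-1); case: (eqVneq i' n.-1); lia.
apply: leq_trans (dist_le_diameter u v).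
have /walkP[p [pp lp sp]] := walk_dist u v conG.
have := path_lipschitz lip pp; rewrite lp sp /phi ku kv eqxx.
by case: eqP; lia.
Qed.

End SpineCode.

Lemma caterpillar_coded (G : sgraph) : caterpillar G -> diameter G = 4 ->
  exists j a b, [/\ 0 < a, 0 < b & coded G j a b].
Proof.
move=> catG diam; have conG := catG.1.1.
have [|n [k [diam_n k_leaf k_lt k_spine k_adj]]] := caterpillar_code catG.
  by rewrite diam.
(* The bounds from both sides make the diameter n + 1. *)
have n3 : n = 3.
  have := spine_diameter k_leaf k_lt k_spine k_adj conG; lia.
move: diam_n k_lt k_spine; rewrite n3 => _ k_lt k_spine {n3 n}.
pose N x := count_mem x (map k (enum G)).
have N_gt0 v : 0 < N (k v).
  by rewrite -has_count has_pred1 map_f ?mem_enum.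
exists (N (true, 1)), (N (true, 0)), (N (true, 2)); split.
- have [v <-] : exists v, k v = (true, 0).
    by apply: (spine_end_leaf k_leaf k_lt k_spine k_adj (i' := 1)) => // -[|[|[|]]].
  exact: N_gt0.
- have [v <-] : exists v, k v = (true, 2).
    by apply: (spine_end_leaf k_leaf k_lt k_spine k_adj (i' := 1)) => // -[|[|[|]]].
  exact: N_gt0.
exists k; split=> //; apply/allP => x; rewrite mem_cat => xk /=.
have {xk} : x \in code_range.
  case/orP: xk => [/mapP[v _ ->]|/codes_range //].
  by have := k_lt v; case: (k v) => [[] [|[|[|]]]].
have Nspine i : i < 3 -> N (false, i) = 1.
  move=> /k_spine <-; rewrite cardsE cardE -sum1_size /N count_map -sum1_count.
  by rewrite big_enum_cond [RHS]big_enum.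
rewrite -/(N x) !inE => /or4P[|||/or3P[]] /eqP->; rewrite ?Nspine //= !count_cat !count_nseq /=;
  by rewrite ?addn0 ?add0n ?mul1n.
Qed.

(** * The classification *)

Theorem theorem2 :
  (forall G : sgraph,
     caterpillar G -> diameter G = 4 -> odd #|edges G| ->
     ~ (exists j a : nat,
          [/\ odd j, odd a, j = 1 \/ a = 1
            & isomorphic G (RT (nseq j 0 ++ [:: 1; a]))]) ->
     super_edge_graceful G) /\
  (forall j a : nat,
     odd j -> odd a -> j = 1 \/ a = 1 ->
     ~ super_edge_graceful (RT (nseq j 0 ++ [:: 1; a]))).
Proof.
have seg (G : sgraph) j a b : coded G j a b ->
    #|edges G| = (j + a + b).+2 /\ (super_edge_graceful G <-> label_lists j a b).
  by move=> [k [adj_k codes_k]]; apply: seg_label_lists_of_code adj_k codes_k.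
split=> [G catG diam odd_q exc|j a oj oa ja]; last first.
  by rewrite (seg _ _ _ _ (RT_coded j a)).2; apply: label_lists_impossible.
have [j [a [b [a0 b0 codG]]]] := caterpillar_coded catG diam.
have [qE ->] := seg _ _ _ _ codG.
apply: label_lists_exist => //; first by rewrite qE /= negbK in odd_q.
move=> [oj oa ob ones]; apply: exc.
(* If a = 1, then x is the child with one leaf; otherwise [ones] forces b = 1, and x and y are
   exchanged. *)
have [a1|a1] := eqVneq a 1.
  exists j, b; split=> //; first by lia.
  by rewrite a1 in codG; apply: coded_isomorphic codG (RT_coded j b).
exists j, a; split=> //; first by lia.
have b1 : b = 1 by lia.
by rewrite b1 in codG; apply: coded_isomorphic (codedC codG) (RT_coded j a).
Qed.
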